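(* Let $\lambda<1$ and $g(t)=+\sqrt{\lambda t^2+1}$. Let $T=+\infty$ if $\lambda\ge0$ and $T=1/\sqrt{-\lambda}$ if $\lambda<0$. For every sufficiently small $\epsilon>0$ (in particular $\epsilon<T$) there exist a number $\sigma=\sigma(\epsilon)\in(0,\epsilon)$ and a continuous function $f\colon[\sigma,T)\to(0,+\infty)$, smooth on $(\sigma,T)$, which satisfies $$f(t)\left(f''(t)+\frac{f'(t)^3}{t}\right)<1\quad\text{and}\quad\frac{f(t)f'(t)}{t}<1\qquad(t\in(\sigma,T))$$ and the following: (i) $f(t)=g(t)$ for $\epsilon\le t<T$; (ii) $f(t)>g(t)$ for $\sigma\le t<\epsilon$; (iii) $f'(\sigma+)=\lim_{t\downarrow\sigma}f'(t)=-\infty$; (iv) there is a smooth inverse function of $f$ near the point $u=f(\sigma)$, extended by the value $\sigma$ for $u\ge f(\sigma)$, which satisfies the same inequalities; that is, there is $\delta>0$ with $\sigma+\delta<T$ such that $f$ is strictly decreasing on $[\sigma,\sigma+\delta)$, and the function $h$ defined on $(\lim_{t\uparrow\sigma+\delta}f(t),+\infty)$ by $h(u)=(f|_{[\sigma,\sigma+\delta)})^{-1}(u)$ for $u\le f(\sigma)$ and $h(u)=\sigma$ for $u\ge f(\sigma)$ is smooth and satisfies $$h(u)\left(h''(u)+\frac{h'(u)^3}{u}\right)<1\quad\text{and}\quad\frac{h(u)h'(u)}{u}<1$$ on its domain.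
   Context: ''Smooth'' means $C^\infty$. All functions are real-valued functions of one real variable. *)

(* Defs.v *)
From Stdlib Require Import Reals.
From Coquelicot Require Import Coquelicot.
Open Scope R_scope.

(* Functions on an interval are total functions R -> R of which only the
   restriction matters; [D] is meant to be open, so that the two-sided
   derivatives below depend only on the restriction of [f] to [D]. *)
Definition smooth_on (D : R -> Prop) (f : R -> R) : Prop :=
  forall x : R, D x -> forall n : nat, ex_derive_n f n x.

Definition profile_ineqs (f : R -> R) (t : R) : Prop :=
  f t * (Derive_n f 2 t + Derive f t ^ 3 / t) < 1 /\
  f t * Derive f t / t < 1.

Definition g (lambda t : R) : R := sqrt (lambda * t ^ 2 + 1).

Definition T (lambda : R) : Rbar :=
  if Rle_dec 0 lambda then p_infty else Finite (1 / sqrt (- lambda)).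

Definition strictly_decreasing_on (D : R -> Prop) (f : R -> R) : Prop :=
  forall s t : R, D s -> D t -> s < t -> f t < f s.

(* [h] is, on (L, +oo), the inverse of the restriction of [f] to [s, b)
   continued by the constant [s] beyond [f s]. When [f] is injective on [s, b)
   this determines [h] on (L, +oo). *)
Definition extended_inverse (f : R -> R) (s b L : R) (h : R -> R) : Prop :=
  (forall u : R, L < u <= f s -> s <= h u < b /\ f (h u) = u) /\
  (forall u : R, f s <= u -> h u = s).

(* Main.v *)
Require Import Defs.
From Stdlib Require Import Reals Factorial Lra Lia.
From Coquelicot Require Import Coquelicot.
Open Scope R_scope.

(** The equation [f'' = - f'^3 / t] integrates to [1 / f'^2 = 2 ln (t / s)] for a
    constant [s > 0]: a solution that has a negative slope at some [t], however
    small in absolute value, reaches slope [- oo] at the positive time [s]. So it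
    is enough to leave the graph of [g] at [eps], going left, with a slope that
    becomes slightly negative, and then to follow a curve satisfying
    [f'' + f'^3 / t < 0] until it is vertical. The price is only that [sigma] may
    be extremely small.

    The steep part is easiest to describe by its inverse [t = H x], where
    [x = f sigma - f t]: the two inequalities then reduce to [H H'' < 1] and
    [H' >= 0], the first of which is also the one needed for [h]. The function
    [H] must be constant for [x <= 0], smooth, and reach a prescribed large slope
    while [H] is still small; [steep_profile] gives an explicit formula, and
    [steep_graph] transports it to the inverse function [G], so that
    [f = const - G].

    Near [eps] the slope of [g] is diminished by a multiple of the flat function
    [exp (-1 / (eps - t))]. This raises the second derivative, which is possible
    since [g (g'' + g'^3 / t) <= lambda < 1] and [f] stays close to [g]
    ([small_scale]).

    On an interval [[t1, 2 t1]] the slope is interpolated between those of the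
    two parts ([glued_graph]). The left one has the larger slope, so going right
    the interpolation pulls the slope down, and its contribution to [f''] has the
    favourable sign. Then [f] is the primitive of this slope that agrees with [g]
    at [eps]. *)

(** * Finite orders of differentiability *)

(** Recursing on [Derive f], instead of asking for all [Derive_n f k] at once,
    makes every closure property below an induction whose step is a single
    application of a differentiation rule. *)
Fixpoint Ck (n : nat) (D : R -> Prop) (f : R -> R) : Prop :=
  match n with
  | O => True
  | S m => (forall x, D x -> ex_derive f x) /\ Ck m D (Derive f)
  end.

Lemma Ck_ext n (D : R -> Prop) f1 f2 : open D ->
  (forall x, D x -> f1 x = f2 x) -> Ck n D f1 -> Ck n D f2.
Proof.
intros HD; revert f1 f2; induction n as [|n IH]; intros f1 f2 E; [easy|].
intros [H1 H2]; split.
- intros x Hx; apply ex_derive_ext_loc with f1; [|now apply H1].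
  apply filter_imp with D; [intros y Hy; now apply E | now apply HD].
- apply IH with (Derive f1); [|assumption].
  intros x Hx; apply Derive_ext_loc.
  apply filter_imp with D; [intros y Hy; now apply E | now apply HD].
Qed.

Lemma Ck_of_derive n (D : R -> Prop) f df : open D ->
  (forall x, D x -> is_derive f x (df x)) -> Ck n D df -> Ck (S n) D f.
Proof.
intros HD E H; split.
- intros x Hx; exists (df x); now apply E.
- apply Ck_ext with df; try assumption.
  intros x Hx; symmetry; now apply is_derive_unique, E.
Qed.

Lemma Ck_pred n D f : Ck (S n) D f -> Ck n D f.
Proof.
revert f; induction n as [|n IH]; intros f [H1 H2]; [easy|].
split; [assumption | now apply IH].
Qed.

Lemma Ck_sub n (D E : R -> Prop) f :
  (forall x, E x -> D x) -> Ck n D f -> Ck n E f.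
Proof.
intros HE; revert f; induction n as [|n IH]; intros f; [easy|].
intros [H1 H2]; split; [intros x Hx; now apply H1, HE | now apply IH].
Qed.

Lemma smooth_on_Ck (D : R -> Prop) f :
  (forall n, Ck n D f) -> smooth_on D f.
Proof.
intros H x Hx [|n]; [easy|]; simpl.
generalize (H (S n)); clear H; revert f; induction n as [|n IH]; intros f [H1 H2].
- now apply H1.
- apply ex_derive_ext with (Derive_n (Derive f) n); [|now apply IH].
  intros t; change (Derive_n (Derive_n f 1) n t = Derive_n f (S n) t).
  rewrite Derive_n_comp; f_equal; lia.
Qed.

Lemma Ck_const n D c : Ck n D (fun _ => c).
Proof.
apply (Ck_sub n (fun _ => True)); [easy|].
revert c; induction n as [|n IH]; intros c; [easy|].
apply Ck_of_derive with (fun _ => 0); [apply open_true | | apply IH].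
intros x _; auto_derive; [exact I | reflexivity].
Qed.

Lemma Ck_id n D : Ck n D (fun x => x).
Proof.
apply (Ck_sub n (fun _ => True)); [easy|].
destruct n as [|n]; [easy|].
apply Ck_of_derive with (fun _ => 1); [apply open_true | | apply Ck_const].
intros x _; auto_derive; [exact I | reflexivity].
Qed.

Lemma Ck_plus n D f1 f2 : open D -> Ck n D f1 -> Ck n D f2 ->
  Ck n D (fun x => f1 x + f2 x).
Proof.
intros HD; revert f1 f2; induction n as [|n IH]; intros f1 f2; [easy|].
intros [H1 H1'] [H2 H2'].
apply Ck_of_derive with (fun x => Derive f1 x + Derive f2 x); [assumption| |now apply IH].
intros x Hx; apply (is_derive_plus f1 f2); apply Derive_correct; auto.
Qed.

Lemma Ck_mult n D f1 f2 : open D -> Ck n D f1 -> Ck n D f2 ->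
  Ck n D (fun x => f1 x * f2 x).
Proof.
intros HD; revert f1 f2; induction n as [|n IH]; intros f1 f2; [easy|].
intros H1 H2; assert (P1 := Ck_pred _ _ _ H1); assert (P2 := Ck_pred _ _ _ H2).
destruct H1 as [H1 H1'], H2 as [H2 H2'].
apply Ck_of_derive with (fun x => Derive f1 x * f2 x + f1 x * Derive f2 x).
- assumption.
- intros x Hx; apply Derive.is_derive_mult; apply Derive_correct; auto.
- apply Ck_plus; [assumption | apply IH | apply IH]; assumption.
Qed.

Lemma Ck_scal n D c f : open D -> Ck n D f -> Ck n D (fun x => c * f x).
Proof. intros HD H; apply Ck_mult; auto using Ck_const. Qed.

Lemma Ck_opp n D f : open D -> Ck n D f -> Ck n D (fun x => - f x).
Proof.
intros HD H; apply Ck_ext with (fun x => -1 * f x); [assumption | intros; ring|].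
now apply Ck_scal.
Qed.

Lemma Ck_minus n D f1 f2 : open D -> Ck n D f1 -> Ck n D f2 ->
  Ck n D (fun x => f1 x - f2 x).
Proof.
intros HD H1 H2.
apply (Ck_plus n D f1 (fun x => - f2 x)); auto using Ck_opp.
Qed.

Lemma Ck_inv n D f : open D -> (forall x, D x -> f x <> 0) -> Ck n D f ->
  Ck n D (fun x => / f x).
Proof.
intros HD H0; induction n as [|n IH]; [easy|].
intros H; assert (P := Ck_pred _ _ _ H); destruct H as [H1 H2].
apply Ck_of_derive with (fun x => - Derive f x * (/ f x * / f x)).
- assumption.
- intros x Hx; assert (f x <> 0) by auto.
  replace (- Derive f x * (/ f x * / f x)) with (- Derive f x / f x ^ 2)
    by (field; assumption).
  apply is_derive_inv; auto; apply Derive_correct; auto.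
- apply Ck_mult; auto using Ck_mult, Ck_opp.
Qed.

Lemma Ck_div n D f1 f2 : open D -> (forall x, D x -> f2 x <> 0) ->
  Ck n D f1 -> Ck n D f2 -> Ck n D (fun x => f1 x / f2 x).
Proof.
intros HD H0 H1 H2.
apply (Ck_mult n D f1 (fun x => / f2 x)); auto using Ck_inv.
Qed.

Lemma Ck_comp n (D E : R -> Prop) f1 f2 : open D ->
  (forall x, D x -> E (f2 x)) -> Ck n E f1 -> Ck n D f2 ->
  Ck n D (fun x => f1 (f2 x)).
Proof.
intros HD HE; revert f1; induction n as [|n IH]; intros f1; [easy|].
intros [H1 H1'] H2; assert (P2 := Ck_pred _ _ _ H2); destruct H2 as [H2 H2'].
apply Ck_of_derive with (fun x => Derive f2 x * Derive f1 (f2 x)).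
- assumption.
- intros x Hx; apply (is_derive_comp f1 f2); apply Derive_correct; auto.
- apply Ck_mult; auto.
Qed.

(** The derivative of an inverse function is an expression in that function
    and the given one, so each order of differentiability gives the next. *)
Lemma Ck_inverse n (D E : R -> Prop) H' G : open D ->
  (forall x, D x -> E (G x)) -> (forall x, E x -> H' x <> 0) ->
  (forall x, D x -> is_derive G x (/ H' (G x))) ->
  Ck n E H' -> Ck n D G.
Proof.
intros HD HE H0 HG; induction n as [|n IH]; [easy|].
intros H; assert (P := Ck_pred _ _ _ H).
apply Ck_of_derive with (fun x => / H' (G x)); auto.
apply Ck_inv; auto.
apply Ck_comp with E; auto.
Qed.

Lemma Ck_primitive (D : R -> Prop) f F : open D ->
  (forall x, D x -> is_derive F x (f x)) ->
  (forall n, Ck n D f) -> forall n, Ck n D F.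
Proof.
intros HD HF Hf [|n]; [easy | now apply Ck_of_derive with f].
Qed.

Lemma Ck_continuous D f x : Ck 1 D f -> D x -> continuous f x.
Proof. intros [H _] Hx; apply @ex_derive_continuous; auto. Qed.

(** * Functions that are flat at the origin *)

(** The monomial factor is there because the functions [x^a exp(-x^(-al))],
    with [al] fixed and [a] any real number, span a space closed under
    differentiation. *)
Definition flat (a al x : R) : R :=
  if Rlt_dec 0 x then Rpower x a * exp (- Rpower x (- al)) else 0.

Lemma flat_pos_eq a al x : 0 < x ->
  flat a al x = Rpower x a * exp (- Rpower x (- al)).
Proof. intros Hx; unfold flat; destruct (Rlt_dec 0 x); [easy | lra]. Qed.

Lemma flat_nonpos a al x : x <= 0 -> flat a al x = 0.
Proof. intros Hx; unfold flat; destruct (Rlt_dec 0 x); [lra | easy]. Qed.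

Lemma flat_pos a al x : 0 < x -> 0 < flat a al x.
Proof.
intros Hx; rewrite flat_pos_eq by assumption.
apply Rmult_lt_0_compat; apply exp_pos.
Qed.

Lemma flat_nonneg a al x : 0 <= flat a al x.
Proof.
destruct (Rlt_le_dec 0 x) as [Hx|Hx].
- now apply Rlt_le, flat_pos.
- rewrite flat_nonpos by assumption; lra.
Qed.

Lemma exp_le_mono x y : x <= y -> exp x <= exp y.
Proof.
intros H; destruct (Rle_lt_or_eq_dec _ _ H) as [I|I].
- now apply Rlt_le, exp_increasing.
- rewrite I; apply Rle_refl.
Qed.

Lemma pow_exp_opp_bound N y : 0 <= y -> y ^ N * exp (- y) <= INR (fact N).
Proof.
intros Hy.
assert (F : 0 < INR (fact N)) by apply INR_fact_lt_0.
assert (E := exp_ge_taylor y N Hy).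
assert (L : y ^ N / INR (fact N) <= exp y).
{ apply Rle_trans with (2 := E).
  destruct N as [|N]; [simpl; lra|]. rewrite tech5.
  assert (0 <= sum_f_R0 (fun k => y ^ k / INR (fact k)) N); [|lra].
  apply cond_pos_sum; intros k; apply Rcomplements.Rdiv_le_0_compat;
    [now apply pow_le | apply INR_fact_lt_0]. }
assert (P := exp_pos (- y)).
assert (I : exp y * exp (- y) = 1) by (rewrite <- exp_plus, Rplus_opp_r; apply exp_0).
apply Rmult_le_compat_r with (r := INR (fact N) * exp (- y)) in L; [|nra].
replace (y ^ N / INR (fact N) * (INR (fact N) * exp (- y)))
  with (y ^ N * exp (- y)) in L by (field; lra).
nra.
Qed.

(** With [y = x^(-al) >= 1], the factor [x^a] is at most a natural power of [y],
    and [exp (-y)] beats every power of [y]. *)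
Lemma flat_bounded_unit a al : 0 < al ->
  exists C, 0 < C /\ forall x, 0 < x <= 1 -> flat a al x <= C.
Proof.
intros Hal.
destruct (nfloor_ex (Rabs a / al)) as [N [_ HN]].
{ apply Rdiv_le_0_compat; [apply Rabs_pos | assumption]. }
exists (INR (fact (S N))); split; [apply INR_fact_lt_0|].
intros x [Hx0 Hx1]; rewrite flat_pos_eq by assumption.
set (y := Rpower x (- al)).
assert (Hy : 0 < y) by apply exp_pos.
apply Rle_trans with (y ^ S N * exp (- y)); [|apply pow_exp_opp_bound; lra].
apply Rmult_le_compat_r; [apply Rlt_le, exp_pos|].
rewrite <- Rpower_pow by assumption.
unfold y; rewrite Rpower_mult; unfold Rpower.
assert (ln x <= 0) by (rewrite <- ln_1; apply Rcomplements.ln_le; assumption).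
assert (HNa : - a <= al * INR (S N)).
{ rewrite S_INR; apply Rmult_lt_compat_r with (r := al) in HN; [|assumption].
  unfold Rdiv in HN; rewrite Rmult_assoc, Rinv_l, Rmult_1_r in HN by lra.
  assert (K := Rle_abs (- a)); rewrite Rabs_Ropp in K; lra. }
apply exp_le_mono; nra.
Qed.

Lemma flat_bounded a al : 0 < al -> a <= 0 ->
  exists C, 0 < C /\ forall x, flat a al x <= C.
Proof.
intros Hal Ha; destruct (flat_bounded_unit a al Hal) as [C [HC H]].
exists (Rmax C 1); split; [apply Rlt_le_trans with C; [assumption | apply Rmax_l]|].
intros x; destruct (Rle_lt_dec x 0) as [Hx|Hx].
- rewrite flat_nonpos by assumption.
  apply Rle_trans with C; [lra | apply Rmax_l].
- destruct (Rle_lt_dec x 1) as [H1|H1].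
  + apply Rle_trans with C; [now apply H | apply Rmax_l].
  + apply Rle_trans with 1; [|apply Rmax_r].
    rewrite flat_pos_eq by assumption.
    replace 1 with (1 * 1) by ring; apply Rmult_le_compat; try apply Rlt_le, exp_pos.
    * rewrite <- exp_0; unfold Rpower; apply exp_le_mono.
      assert (0 < ln x) by (rewrite <- ln_1; apply ln_increasing; lra); nra.
    * rewrite <- exp_0; apply exp_le_mono.
      assert (0 < Rpower x (- al)) by apply exp_pos; lra.
Qed.

Lemma is_derive_of_quadratic_bound f C : 0 < C ->
  (forall x, Rabs x <= 1 -> Rabs (f x) <= C * x ^ 2) -> is_derive f 0 0.
Proof.
intros HC H; apply is_derive_Reals; intros eps Heps.
assert (Hd : 0 < Rmin 1 (eps / C)).
{ apply Rmin_pos; [lra | now apply Rdiv_lt_0_compat]. }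
exists (mkposreal _ Hd); intros h Hh0 Hh; simpl in Hh.
assert (f0 : f 0 = 0).
{ assert (K := H 0); rewrite Rabs_R0 in K; specialize (K Rle_0_1).
  replace (C * 0 ^ 2) with 0 in K by ring.
  apply Rabs_eq_0; apply Rle_antisym; [assumption | apply Rabs_pos]. }
rewrite f0, Rplus_0_l, !Rminus_0_r.
assert (Hh1 : Rabs h < 1) by (apply Rlt_le_trans with (1 := Hh), Rmin_l).
assert (Hh2 : Rabs h < eps / C) by (apply Rlt_le_trans with (1 := Hh), Rmin_r).
assert (Hp : 0 < Rabs h) by now apply Rabs_pos_lt.
rewrite Rabs_div by assumption.
apply Rle_lt_trans with (C * Rabs h).
- apply Rle_div_l; [assumption|].
  replace (C * Rabs h * Rabs h) with (C * h ^ 2); [apply H; lra|].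
  rewrite <- (pow2_abs h); ring.
- apply Rlt_div_r in Hh2; [lra | assumption].
Qed.

(** At the origin: dividing by [x^2] only lowers the exponent [a] by 2, which
    leaves a bounded function, so [flat a al] is [O(x^2)] there. *)
Lemma is_derive_flat a al x : 0 < al ->
  is_derive (flat a al) x (a * flat (a - 1) al x + al * flat (a - al - 1) al x).
Proof.
intros Hal; destruct (Rtotal_order x 0) as [Hx|[Hx|Hx]].
- rewrite !flat_nonpos, !Rmult_0_r, Rplus_0_l by lra.
  apply is_derive_ext_loc with (fun _ => 0); [|now auto_derive].
  apply filter_imp with (fun y => y < 0); [|now apply (open_lt 0)].
  intros y Hy; symmetry; apply flat_nonpos; lra.
- subst x; rewrite !flat_nonpos, !Rmult_0_r, Rplus_0_l by lra.
  destruct (flat_bounded_unit (a - 2) al Hal) as [C [HC H]].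
  apply is_derive_of_quadratic_bound with C; [assumption|].
  intros x Hx; rewrite Rabs_pos_eq by apply flat_nonneg.
  destruct (Rle_lt_dec x 0) as [H0|H0].
  + rewrite flat_nonpos by assumption; nra.
  + rewrite Rabs_pos_eq in Hx by lra.
    apply Rle_trans with (flat (a - 2) al x * x ^ 2).
    * rewrite !flat_pos_eq by assumption.
      replace (Rpower x a) with (Rpower x (a - 2) * x ^ 2); [right; ring|].
      rewrite <- Rpower_pow, <- Rpower_plus by assumption.
      f_equal; simpl; ring.
    * apply Rmult_le_compat_r; [nra | apply H; lra].
- apply is_derive_ext_loc with (fun y => exp (a * ln y) * exp (- exp (- al * ln y))).
  { apply filter_imp with (fun y => 0 < y); [|now apply (open_gt 0)].
    intros y Hy; now rewrite flat_pos_eq. }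
  rewrite !flat_pos_eq by assumption.
  replace (a - al - 1) with (a + - al + - (1)) by ring.
  replace (a - 1) with (a + - (1)) by ring.
  rewrite !Rpower_plus, (Rpower_Ropp x 1), Rpower_1 by assumption.
  unfold Rpower; auto_derive; [now split|].
  field; lra.
Qed.

Lemma Ck_flat n D a al : 0 < al -> Ck n D (flat a al).
Proof.
intros Hal; apply (Ck_sub n (fun _ => True)); [easy|].
revert a; induction n as [|n IH]; intros a; [easy|].
eapply Ck_of_derive; [apply open_true | intros x _; now apply is_derive_flat |].
apply Ck_plus; auto using open_true, Ck_scal.
Qed.

(** * A smooth step *)
Definition bump (x : R) : R := flat 0 1 x.

Lemma is_derive_bump x : is_derive bump x (flat (-2) 1 x).
Proof.
assert (K := is_derive_flat 0 1 x Rlt_0_1).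
replace (flat (-2) 1 x)
  with (0 * flat (0 - 1) 1 x + 1 * flat (0 - 1 - 1) 1 x); [exact K|].
rewrite Rmult_0_l, Rplus_0_l, Rmult_1_l; f_equal; ring.
Qed.

(** The slope of [exp (-1/x)] is [z^2 exp (-z)] with [z = 1/x]. *)
Lemma bump_slope_le_2 x : flat (-2) 1 x <= 2.
Proof.
destruct (Rle_lt_dec x 0) as [Hx|Hx]; [rewrite flat_nonpos by assumption; lra|].
rewrite flat_pos_eq by assumption.
replace (-2) with (- (1) * INR 2) by (simpl; ring).
rewrite <- Rpower_mult, Rpower_pow by apply exp_pos.
replace 2 with (INR (fact 2)) at 2 by (simpl; ring).
apply pow_exp_opp_bound, Rlt_le, exp_pos.
Qed.

Lemma bump_le_1 x : bump x <= 1.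
Proof.
unfold bump; destruct (Rle_lt_dec x 0) as [Hx|Hx]; [rewrite flat_nonpos by assumption; lra|].
rewrite flat_pos_eq, Rpower_O, Rmult_1_l by assumption.
apply Rle_trans with (exp 0); [apply exp_le_mono | right; apply exp_0].
assert (0 < Rpower x (- (1))) by apply exp_pos; lra.
Qed.

Lemma bump_nondecreasing x y : x <= y -> bump x <= bump y.
Proof.
intros H; destruct (Rle_lt_or_eq_dec _ _ H) as [I|I]; [|rewrite I; apply Rle_refl].
destruct (MVT_gen bump x y (flat (-2) 1)) as [c [_ Hc]].
- intros; apply is_derive_bump.
- intros t _; apply continuity_pt_filterlim, @ex_derive_continuous.
  eexists; apply is_derive_bump.
- assert (0 <= flat (-2) 1 c) by apply flat_nonneg; nra.
Qed.

Definition step (x : R) : R := bump x / (bump x + bump (1 - x)).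

Lemma step_denominator_pos x : 0 < bump x + bump (1 - x).
Proof.
destruct (Rle_lt_dec x 0) as [Hx|Hx].
- apply Rplus_le_lt_0_compat; [apply flat_nonneg | apply flat_pos; lra].
- apply Rplus_lt_le_0_compat; [now apply flat_pos | apply flat_nonneg].
Qed.

Lemma step_0 x : x <= 0 -> step x = 0.
Proof.
intros H; unfold step, bump at 1; rewrite flat_nonpos by assumption.
unfold Rdiv; apply Rmult_0_l.
Qed.

Lemma step_1 x : 1 <= x -> step x = 1.
Proof.
intros H; assert (K := step_denominator_pos x); unfold step; revert K.
unfold bump at 2 5; rewrite flat_nonpos by lra; intros K; field; lra.
Qed.

Lemma step_range x : 0 <= step x <= 1.
Proof.
assert (K := step_denominator_pos x).
assert (P : 0 <= bump x) by apply flat_nonneg.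
assert (Q : 0 <= bump (1 - x)) by apply flat_nonneg.
unfold step; split.
- now apply Rcomplements.Rdiv_le_0_compat.
- apply Rle_div_l; lra.
Qed.

Definition step_slope (x : R) : R :=
  (flat (-2) 1 x * bump (1 - x) + bump x * flat (-2) 1 (1 - x)) /
  (bump x + bump (1 - x)) ^ 2.

Lemma is_derive_step x : is_derive step x (step_slope x).
Proof.
assert (K := step_denominator_pos x).
assert (D : is_derive (fun t => bump (1 - t)) x (- flat (-2) 1 (1 - x))).
{ replace (- flat (-2) 1 (1 - x)) with (scal (-1) (flat (-2) 1 (1 - x)))
    by (unfold scal; simpl; unfold mult; simpl; ring).
  apply (is_derive_comp bump (fun t => 1 - t)); [apply is_derive_bump|].
  auto_derive; [exact I | ring]. }
replace (step_slope x) with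
  ((flat (-2) 1 x * (bump x + bump (1 - x))
    - bump x * (flat (-2) 1 x + - flat (-2) 1 (1 - x)))
   / (bump x + bump (1 - x)) ^ 2).
- apply (is_derive_div bump (fun t => bump t + bump (1 - t)));
    [apply is_derive_bump | | lra].
  apply (is_derive_plus bump (fun t => bump (1 - t))); [apply is_derive_bump | exact D].
- unfold step_slope; f_equal; ring.
Qed.

Lemma step_slope_nonneg x : 0 <= step_slope x.
Proof.
assert (K := step_denominator_pos x).
apply Rcomplements.Rdiv_le_0_compat; [|nra].
apply Rplus_le_le_0_compat; apply Rmult_le_pos; apply flat_nonneg.
Qed.

Lemma Ck_step n D : Ck n D step.
Proof.
apply (Ck_sub n (fun _ => True)); [easy|].
assert (B : Ck n (fun _ => True) bump) by (apply Ck_flat; lra).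
apply Ck_div.
- apply open_true.
- intros x _; assert (K := step_denominator_pos x); lra.
- exact B.
- apply Ck_plus; [apply open_true | exact B |].
  apply (Ck_comp n _ (fun _ => True) bump (fun x => 1 - x)); auto using open_true.
  apply Ck_minus; auto using open_true, Ck_const, Ck_id.
Qed.

(** * A flat start followed by an arbitrarily steep rise *)

(** The unscaled rise [cap al y = y exp(-y^(-al))], with its first two
    derivatives. For small [al] its slope grows from 0 to about 1 so slowly, on
    a logarithmic scale, that [cap * cap2] never exceeds [al]. Magnifying the
    slope by [M] multiplies this product by [M^2] only. *)

Definition cap (al y : R) : R := flat 1 al y.
Definition cap1 (al y : R) : R := flat 0 al y + al * flat (- al) al y.
Definition cap2 (al y : R) : R :=
  al * (1 - al) * flat (- al - 1) al y + al ^ 2 * flat (- 2 * al - 1) al y.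

Lemma is_derive_cap al y : 0 < al -> is_derive (cap al) y (cap1 al y).
Proof.
intros Hal; unfold cap1.
replace (flat 0 al y + al * flat (- al) al y)
  with (1 * flat (1 - 1) al y + al * flat (1 - al - 1) al y).
- now apply is_derive_flat.
- rewrite Rmult_1_l; f_equal; [f_equal; ring | do 2 f_equal; ring].
Qed.

Lemma is_derive_cap1 al y : 0 < al -> is_derive (cap1 al) y (cap2 al y).
Proof.
intros Hal; unfold cap1.
replace (cap2 al y) with
  ((0 * flat (0 - 1) al y + al * flat (0 - al - 1) al y)
   + al * (- al * flat (- al - 1) al y + al * flat (- al - al - 1) al y)).
- apply (is_derive_plus (flat 0 al) (fun y => al * flat (- al) al y)).
  + now apply is_derive_flat.
  + apply is_derive_scal; now apply is_derive_flat.
- unfold cap2.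
  replace (0 - al - 1) with (- al - 1) by ring.
  replace (- al - al - 1) with (- 2 * al - 1) by ring.
  ring.
Qed.

Lemma cap_formulas al y : 0 < y ->
  let z := Rpower y (- al) in
  cap al y = y * exp (- z) /\
  cap1 al y = (1 + al * z) * exp (- z) /\
  cap2 al y = al * ((1 - al) * z + al * z ^ 2) / y * exp (- z).
Proof.
intros Hy z; unfold cap, cap1, cap2; rewrite !flat_pos_eq by assumption; fold z.
replace (- al - 1) with (- al + - (1)) by ring.
replace (- 2 * al - 1) with (- al + - al + - (1)) by ring.
rewrite !Rpower_plus, (Rpower_Ropp y 1), Rpower_1, Rpower_O by assumption; fold z.
repeat split; try ring; field; lra.
Qed.

Lemma one_plus_exp_opp z : (1 + z) * exp (- z) <= 1.
Proof.
assert (H := exp_ineq1_le z); assert (P := exp_pos (- z)).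
assert (I : exp z * exp (- z) = 1) by (rewrite <- exp_plus, Rplus_opp_r; apply exp_0).
nra.
Qed.

Lemma cap1_range al y : 0 < al <= 1 -> 0 < y -> 0 < cap1 al y <= 1.
Proof.
intros Hal Hy; destruct (cap_formulas al y Hy) as [_ [-> _]].
set (z := Rpower y (- al)); assert (Hz : 0 < z) by apply exp_pos.
assert (K := one_plus_exp_opp z); assert (P := exp_pos (- z)).
split.
- apply Rmult_lt_0_compat; [nra | assumption].
- apply Rle_trans with (2 := K); apply Rmult_le_compat_r; nra.
Qed.

(** The factor [y] of [cap] cancels the factor [1 / y] of [cap2]; what remains
    is [al] times a function of [z = y^(-al)] that is at most
    [((1 + z) exp (-z))^2 <= 1]. *)
Lemma cap_mul_cap2_le al y : 0 < al <= 1 -> cap al y * cap2 al y <= al.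
Proof.
intros Hal; destruct (Rle_lt_dec y 0) as [Hy|Hy].
- unfold cap; rewrite flat_nonpos by assumption; lra.
- destruct (cap_formulas al y Hy) as [-> [_ ->]].
  set (z := Rpower y (- al)); assert (Hz : 0 < z) by apply exp_pos.
  assert (K := one_plus_exp_opp z); assert (P := exp_pos (- z)).
  set (E := exp (- z)) in *.
  replace (y * E * (al * ((1 - al) * z + al * z ^ 2) / y * E))
    with (al * (((1 - al) * z + al * z ^ 2) * E ^ 2)) by (field; lra).
  assert (Q : ((1 + z) * E) ^ 2 <= 1).
  { replace 1 with (1 ^ 2) at 2 by ring; apply pow_incr; split; [nra | exact K]. }
  assert (((1 - al) * z + al * z ^ 2) * E ^ 2 <= 1); [|nra].
  apply Rle_trans with (2 := Q); rewrite Rpow_mult_distr.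
  apply Rmult_le_compat_r; [nra|nra].
Qed.

Lemma cap2_bounded al : 0 < al <= 1 -> exists C, 0 < C /\ forall y, cap2 al y <= C.
Proof.
intros Hal.
destruct (flat_bounded (- al - 1) al) as [C1 [P1 H1]]; [lra | lra |].
destruct (flat_bounded (- 2 * al - 1) al) as [C2 [P2 H2]]; [lra | lra |].
exists (C1 + C2); split; [lra|]; intros y; unfold cap2.
assert (F1 := flat_nonneg (- al - 1) al y); assert (F2 := flat_nonneg (- 2 * al - 1) al y).
specialize (H1 y); specialize (H2 y).
assert (0 <= al * (1 - al) <= 1) by nra.
assert (0 <= al ^ 2 <= 1) by nra.
apply Rplus_le_compat; nra.
Qed.

Lemma cap_le al y : 0 <= y -> cap al y <= y.
Proof.
intros H; destruct (Rle_lt_or_eq_dec _ _ H) as [I|I].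
- destruct (cap_formulas al y I) as [-> _].
  assert (exp (- Rpower y (- al)) <= 1); [|nra].
  rewrite <- exp_0; apply exp_le_mono.
  assert (0 < Rpower y (- al)) by apply exp_pos; lra.
- unfold cap; rewrite flat_nonpos; lra.
Qed.

Lemma cap_far al y : 0 < al -> 1 <= y -> y / 3 <= cap al y /\ 1 / 3 <= cap1 al y.
Proof.
intros Hal Hy; destruct (cap_formulas al y) as [-> [-> _]]; [lra|].
set (z := Rpower y (- al)); assert (Hz : 0 < z) by apply exp_pos.
assert (z <= 1).
{ unfold z, Rpower; rewrite <- exp_0; apply exp_le_mono.
  assert (0 <= ln y) by (rewrite <- ln_1; apply Rcomplements.ln_le; lra); nra. }
assert (1 / 3 <= exp (- z)).
2: { assert (0 < al * z) by (apply Rmult_lt_0_compat; lra); split.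
     - apply Rmult_le_compat_l with (r := y) in H0; lra.
     - nra. }
apply Rle_trans with (exp (- (1))); [|apply exp_le_mono; lra].
rewrite exp_Ropp; unfold Rdiv; rewrite Rmult_1_l.
apply Rinv_le_contravar; [apply exp_pos | apply exp_le_3].
Qed.

(** The profile is [H x = sigma + M b cap al (x / b)]. In [H H''], the product
    of the two rises is at most [M^2 al], made small by the choice of [al]; the
    contribution of the constant [sigma] is at most [sigma (M / b) sup cap2],
    made small by choosing [sigma] last. The slope is at least [M / 3] once
    [x >= b], and [b] is so small that this is the case as soon as [H] reaches
    [t1]. [X] is an explicit witness that [H] is unbounded; the intermediate
    value theorem turns it into an inverse function. *)
Lemma steep_profile mu t1 : 0 < mu -> 0 < t1 ->
  exists (sigma : R) (H H1 H2 X : R -> R),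
    0 < sigma < t1 /\
    (forall n, Ck n (fun _ => True) H) /\
    (forall x, is_derive H x (H1 x)) /\
    (forall x, is_derive H1 x (H2 x)) /\
    (forall x, x <= 0 -> H x = sigma /\ H1 x = 0) /\
    (forall x, 0 < x -> 0 < H1 x <= 3 / mu) /\
    (forall x, H x * H2 x < 1) /\
    (forall x, t1 <= H x -> / mu <= H1 x) /\
    (forall t, 0 < X t /\ t <= H (X t)).
Proof.
intros Hmu Ht1.
set (M := 3 / mu); assert (HM : 0 < M) by (apply Rdiv_lt_0_compat; lra).
set (al := / (4 * M ^ 2 + 1)).
assert (Hal : 0 < al <= 1).
{ unfold al; split; [apply Rinv_0_lt_compat; nra|].
  rewrite <- Rinv_1; apply Rinv_le_contravar; nra. }
assert (HalM : M ^ 2 * al <= 1 / 4).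
{ unfold al; apply Rle_div_l; nra. }
set (b := t1 / (2 * M)); assert (Hb : 0 < b) by (apply Rdiv_lt_0_compat; lra).
assert (HbM : M * b = t1 / 2) by (unfold b; field; lra).
destruct (cap2_bounded al Hal) as [C [HC HCb]].
set (sigma := Rmin (t1 / 3) (b / (2 * M * C))).
assert (Hs0 : 0 < sigma).
{ apply Rmin_pos; [lra|]; apply Rdiv_lt_0_compat; nra. }
assert (Hs1 : sigma <= t1 / 3) by apply Rmin_l.
assert (Hs2 : sigma * (M / b * C) <= 1 / 2).
{ assert (K : sigma <= b / (2 * M * C)) by apply Rmin_r.
  apply Rmult_le_compat_r with (r := M / b * C) in K.
  - apply Rle_trans with (1 := K); right; field; lra.
  - apply Rmult_le_pos; [|lra]; apply Rlt_le, Rdiv_lt_0_compat; lra. }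
assert (HMb : 0 < M / b) by (apply Rdiv_lt_0_compat; lra).
assert (Hdiv : forall x, is_derive (fun x => x / b) x (/ b)).
{ intros x; auto_derive; [lra | field; lra]. }
assert (Hneg : forall x, x <= 0 -> x / b <= 0).
{ intros x Hx; apply Rle_div_l; lra. }
assert (Hpos : forall x, 0 < x -> 0 < x / b).
{ intros x Hx; now apply Rdiv_lt_0_compat. }
exists sigma, (fun x => sigma + M * b * cap al (x / b)),
  (fun x => M * cap1 al (x / b)), (fun x => M / b * cap2 al (x / b)),
  (fun t => b + 3 * Rabs t / M).
split; [lra|]; split; [|split; [|split; [|split; [|split; [|split; [|split]]]]]].
- intros n; apply Ck_plus; [apply open_true | apply Ck_const|].
  apply Ck_scal; [apply open_true|].
  apply (Ck_comp n _ (fun _ => True) (cap al) (fun x => x / b)); auto using open_true.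
  + apply Ck_flat; lra.
  + apply Ck_mult; auto using open_true, Ck_id, Ck_const.
- intros x.
  replace (M * cap1 al (x / b)) with (0 + M * b * (/ b * cap1 al (x / b)))
    by (field; lra).
  apply (is_derive_plus (fun _ => sigma) (fun x => M * b * cap al (x / b))).
  + now auto_derive.
  + apply is_derive_scal, (is_derive_comp (cap al) (fun x => x / b)); [|apply Hdiv].
    apply is_derive_cap; lra.
- intros x; replace (M / b * cap2 al (x / b)) with (M * (/ b * cap2 al (x / b)))
    by (field; lra).
  apply is_derive_scal, (is_derive_comp (cap1 al) (fun x => x / b)); [|apply Hdiv].
  apply is_derive_cap1; lra.
- intros x Hx; unfold cap, cap1; rewrite !flat_nonpos by auto; split; ring.
- intros x Hx; fold M; assert (K := cap1_range al (x / b) Hal (Hpos x Hx)); nra.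
- intros x; assert (K := cap_mul_cap2_le al (x / b) Hal); specialize (HCb (x / b)).
  replace ((sigma + M * b * cap al (x / b)) * (M / b * cap2 al (x / b)))
    with (sigma * (M / b * cap2 al (x / b)) + M ^ 2 * (cap al (x / b) * cap2 al (x / b)))
    by (field; lra).
  assert (sigma * (M / b * cap2 al (x / b)) <= sigma * (M / b * C)).
  { apply Rmult_le_compat_l; [lra|]; apply Rmult_le_compat_l; lra. }
  assert (0 <= M ^ 2) by nra.
  nra.
- intros x Hx.
  destruct (Rle_lt_dec 1 (x / b)) as [I|I].
  + destruct (cap_far al (x / b)) as [_ J]; [lra | assumption |].
    replace (/ mu) with (M * (1 / 3)) by (unfold M; field; lra).
    apply Rmult_le_compat_l; lra.
  + exfalso; rewrite HbM in Hx.
    destruct (Rle_lt_dec x 0) as [J|J].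
    * assert (K := Hneg x J); unfold cap in Hx; rewrite flat_nonpos in Hx by assumption; lra.
    * assert (K := cap_le al (x / b)); specialize (Hpos x J); nra.
- intros t.
  assert (0 <= 3 * Rabs t / M).
  { apply Rcomplements.Rdiv_le_0_compat; [|lra]; assert (K := Rabs_pos t); lra. }
  split; [lra|].
  destruct (cap_far al ((b + 3 * Rabs t / M) / b)) as [J _]; [lra| |].
  { apply Rle_div_r; lra. }
  apply Rmult_le_compat_l with (r := M * b) in J; [|nra].
  replace (M * b * ((b + 3 * Rabs t / M) / b / 3)) with (M * b / 3 + Rabs t) in J
    by (field; lra).
  assert (K := Rle_abs t); nra.
Qed.

(** * Inverting the profile *)
Lemma is_derive_continuity_pt f x l : is_derive f x l -> continuity_pt f x.
Proof.
intros H; apply continuity_pt_filterlim, @ex_derive_continuous; now exists l.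
Qed.

Lemma strictly_increasing_of_derive f df a b : a < b ->
  (forall x, a < x < b -> is_derive f x (df x)) ->
  (forall x, a <= x <= b -> continuity_pt f x) ->
  (forall x, a < x < b -> 0 < df x) -> f a < f b.
Proof.
intros Hab Hd Hc Hp.
assert (pr : forall c, a < c < b -> derivable_pt f c).
{ intros c Hc'; exists (df c); now apply is_derive_Reals, Hd. }
destruct (MVT f id a b pr (fun c _ => derivable_pt_id c) Hab Hc) as [c [P E]].
{ intros; apply derivable_continuous, derivable_id. }
rewrite derive_pt_id, Rmult_1_r in E; unfold id in E.
rewrite Derive_Reals, (is_derive_unique f c _ (Hd c P)) in E.
specialize (Hp c P); nra.
Qed.

Lemma one_sided_inverse (H X : R -> R) sigma :
  continuity H -> (forall x, x <= 0 -> H x = sigma) ->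
  (forall x y, 0 <= x < y -> H x < H y) ->
  (forall t, 0 < X t /\ t <= H (X t)) ->
  exists G : R -> R,
    (forall t, t <= sigma -> G t = 0) /\
    (forall t, sigma < t -> 0 < G t /\ H (G t) = t).
Proof.
intros Hc H0 Hi HX.
assert (S : forall t, sigma < t -> {x | 0 < x /\ H x = t}).
{ intros t Ht; destruct (HX t) as [Xp Xt].
  destruct (IVT_gen H 0 (X t) t Hc) as [x [Hx E]].
  - rewrite H0 by lra; rewrite Rmin_left, Rmax_right; lra.
  - exists x; rewrite Rmin_left in Hx by lra; split; [|assumption].
    destruct (Rle_lt_dec x 0) as [I|I]; [|assumption].
    rewrite H0 in E by assumption; lra. }
exists (fun t => match Rlt_dec sigma t with
                 | left p => proj1_sig (S t p) | right _ => 0 end).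
split; intros t Ht; destruct (Rlt_dec sigma t) as [p|p]; try easy.
- exfalso; lra.
- exact (proj2_sig (S t p)).
Qed.


(** Monotonicity traps [G t] between [G t0 - eps] and [G t0 + eps] as soon as
    [t] lies between the values of [H] at these points. Where
    [G t0 < eps], the lower bound comes from [G >= 0] instead. *)
Lemma continuous_one_sided_inverse (H G : R -> R) sigma :
  (forall x y, 0 <= x < y -> H x < H y) -> H 0 = sigma ->
  (forall t, t <= sigma -> G t = 0) ->
  (forall t, sigma < t -> 0 < G t /\ H (G t) = t) ->
  forall t, sigma <= t -> continuous G t.
Proof.
intros Hi H0 G0 G1 t0 Ht0.
assert (Gn : forall t, 0 <= G t).
{ intros t; destruct (Rle_lt_dec t sigma) as [I|I].
  - rewrite G0 by assumption; lra.
  - apply Rlt_le; now apply G1. }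
assert (HG : forall t, sigma <= t -> H (G t) = t).
{ intros t Ht; destruct (Rle_lt_or_eq_dec _ _ Ht) as [I|I].
  - now apply G1.
  - rewrite G0 by lra; lra. }
apply filterlim_locally; intros eps; assert (Heps := cond_pos eps).
assert (U : locally t0 (fun t => t < H (G t0 + eps))).
{ apply (open_lt (H (G t0 + eps))).
  rewrite <- (HG t0 Ht0) at 1; apply Hi; specialize (Gn t0); lra. }
assert (L : locally t0 (fun t => G t0 - eps < G t)).
{ destruct (Rlt_le_dec (G t0 - eps) 0) as [I|I].
  - apply filter_forall; intros t; specialize (Gn t); lra.
  - apply filter_imp with (fun t => H (G t0 - eps) < t).
    + intros t Ht.
      assert (sigma <= H (G t0 - eps)).
      { rewrite <- H0; destruct (Rle_lt_or_eq_dec _ _ I) as [J|J].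
        - apply Rlt_le, Hi; lra.
        - rewrite <- J; lra. }
      destruct (Rlt_le_dec (G t0 - eps) (G t)) as [J|J]; [assumption|].
      assert (E := HG t); destruct (Rle_lt_or_eq_dec _ _ J) as [K|K].
      * specialize (Hi (G t) (G t0 - eps)); specialize (Gn t); lra.
      * rewrite K in E; lra.
    + apply (open_gt (H (G t0 - eps))).
      rewrite <- (HG t0 Ht0) at 2; apply Hi; lra. }
generalize (filter_and _ _ U L); apply filter_imp; intros t [Ht1 Ht2].
change (Rabs (G t - G t0) < eps); apply Rabs_def1; [|lra].
destruct (Rlt_le_dec (G t) (G t0 + eps)) as [J|J]; [lra|].
exfalso; destruct (Rlt_le_dec sigma t) as [K|K].
- assert (E := HG t); destruct (Rle_lt_or_eq_dec _ _ J) as [M|M].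
  + specialize (Gn t0); assert (H (G t0 + eps) < H (G t)) by (apply Hi; lra); lra.
  + rewrite <- M in E; lra.
- specialize (G0 t K); specialize (Gn t0); lra.
Qed.

Lemma is_derive_inverse (H G : R -> R) t l :
  locally t (fun s => H (G s) = s) -> continuous G t ->
  is_derive H (G t) l -> 0 < l -> is_derive G t (/ l).
Proof.
intros HG Gc Hd Hl; apply is_derive_Reals; intros eps Heps.
apply is_derive_Reals in Hd.
set (eta := Rmin (l / 2) (eps * l ^ 2 / 2)).
assert (Heta : 0 < eta).
{ assert (0 < l ^ 2) by now apply pow_lt.
  apply Rmin_pos; [lra|]; assert (0 < eps * l ^ 2) by now apply Rmult_lt_0_compat.
  lra. }
assert (e1 : eta <= l / 2) by apply Rmin_l.
assert (e2 : eta <= eps * l ^ 2 / 2) by apply Rmin_r.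
destruct (Hd eta Heta) as [d Hd'].
assert (N : locally t (fun s => Rabs (G s - G t) < d)).
{ apply (proj1 (filterlim_locally G (G t)) Gc d). }
destruct (filter_and _ _ HG N) as [d' Hd''].
exists d'; intros h Hh0 Hh.
destruct (Hd'' (t + h)) as [E1 E2].
{ change (Rabs (t + h - t) < d'); now replace (t + h - t) with h by ring. }
assert (E0 : H (G t) = t) by exact (locally_singleton _ _ HG).
set (k := G (t + h) - G t) in *.
assert (Ek : G (t + h) = G t + k) by (unfold k; ring).
assert (Hk : k <> 0).
{ intros K; rewrite Ek, K, Rplus_0_r in E1; lra. }
specialize (Hd' k Hk E2); rewrite <- Ek, E1, E0 in Hd'.
replace (t + h - t) with h in Hd' by ring.
set (q := h / k) in *; apply Rabs_def2 in Hd'.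
assert (Hq : l / 2 < q) by lra.
replace (k / h - / l) with ((l - q) / (q * l)) by (unfold q; field; repeat split; lra).
rewrite Rabs_div by nra; rewrite (Rabs_pos_eq (q * l)) by nra.
apply Rlt_div_l; [nra|].
apply Rabs_def1; nra.
Qed.

(** The graph of [f = const - G] is the profile [H] with the axes exchanged and
    one of them reversed. Since [G' = 1 / H'] and [G'' = - H'' / H'^3], the
    inequality [H H'' < 1] becomes [- G'' < G'^3 / t], that is
    [f'' + f'^3 / t < 0]. This implies the required inequality whatever the
    positive value of [f], so the additive constant stays free. *)
Lemma steep_graph mu t1 : 0 < mu -> 0 < t1 ->
  exists (sigma : R) (H G G1 G2 : R -> R),
    0 < sigma < t1 /\
    (forall n, Ck n (fun _ => True) H) /\
    (forall x, H x * Derive_n H 2 x < 1) /\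
    (forall x, 0 <= Derive H x) /\
    (forall x, x <= 0 -> H x = sigma) /\
    (forall x, 0 <= x -> sigma <= H x /\ G (H x) = x) /\
    (forall n, Ck n (fun t => sigma < t) G) /\
    continuous G sigma /\
    (forall s t, sigma <= s < t -> G s < G t) /\
    G sigma = 0 /\
    (forall t, sigma < t -> is_derive G t (G1 t)) /\
    (forall t, sigma < t -> is_derive G1 t (G2 t)) /\
    filterlim G1 (at_right sigma) (Rbar_locally p_infty) /\
    (forall t, sigma < t -> mu / 3 <= G1 t) /\
    (forall t, t1 <= t -> G1 t <= mu) /\
    (forall t, sigma < t -> - G2 t < G1 t ^ 3 / t).
Proof.
intros Hmu Ht1.
destruct (steep_profile mu t1 Hmu Ht1)
  as (sigma & H & H1 & H2 & X & Hs & Hk & Hd1 & Hd2 & Hneg & Hpos & HH & Hsl & HX).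
assert (Hc : continuity H) by (intros x; eapply is_derive_continuity_pt, Hd1).
assert (Hi : forall x y, 0 <= x < y -> H x < H y).
{ intros x y Hxy; apply strictly_increasing_of_derive with H1; try easy.
  intros z Hz; apply Hpos; lra. }
assert (H00 : H 0 = sigma) by (apply Hneg; lra).
destruct (one_sided_inverse H X sigma Hc) as [G [G0 G']]; try assumption.
{ intros x Hx; now apply Hneg. }
assert (Gc := continuous_one_sided_inverse H G sigma Hi H00 G0 G').
assert (Gd : forall t, sigma < t -> is_derive G t (/ H1 (G t))).
{ intros t Ht; destruct (G' t Ht) as [P E].
  apply is_derive_inverse with H; [| apply Gc; lra | apply Hd1 | now apply Hpos].
  apply filter_imp with (fun s => sigma < s); [|now apply (open_gt sigma)].
  intros s Hs'; now apply G'. }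
assert (H1p : forall t, sigma < t -> 0 < H1 (G t)).
{ intros t Ht; now apply Hpos, G'. }
exists sigma, H, G, (fun t => / H1 (G t)),
  (fun t => - (/ H1 (G t) * H2 (G t)) / H1 (G t) ^ 2).
assert (Gp : forall t, sigma < t -> 0 < G t) by (intros t Ht; now apply G').
repeat match goal with |- _ /\ _ => split; [try assumption|] end.
- intros x; replace (Derive_n H 2 x) with (H2 x); [apply HH|].
  symmetry; apply is_derive_unique.
  apply is_derive_ext with H1; [|apply Hd2].
  intros t; symmetry; now apply is_derive_unique.
- intros x; rewrite (is_derive_unique _ _ _ (Hd1 x)).
  destruct (Rle_lt_dec x 0) as [I|I].
  + replace (H1 x) with 0; [lra | symmetry; now apply Hneg].
  + apply Rlt_le; now apply Hpos.
- intros x Hx; now apply Hneg.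
- intros x Hx; destruct (Rle_lt_or_eq_dec _ _ Hx) as [I|I].
  + assert (J : sigma < H x) by (rewrite <- H00; apply Hi; lra).
    split; [lra|]; destruct (G' _ J) as [P E].
    destruct (Rtotal_order (G (H x)) x) as [K|[K|K]]; [|assumption|].
    * assert (H (G (H x)) < H x) by (apply Hi; lra); lra.
    * assert (H x < H (G (H x))) by (apply Hi; lra); lra.
  + subst x; rewrite H00; split; [lra | apply G0; lra].
- intros n; apply Ck_inverse with (fun x => 0 < x) H1; auto.
  + apply (open_gt sigma).
  + intros x Hx; specialize (Hpos x Hx); lra.
  + apply Ck_sub with (fun _ => True); [easy|].
    apply Ck_ext with (Derive H); [apply open_true | | apply (Hk (S n))].
    intros x _; now apply is_derive_unique.
- apply Gc; lra.
- intros s t Hst; destruct (G' t) as [P E]; [lra|].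
  destruct (Rle_lt_or_eq_dec _ _ (proj1 Hst)) as [I|I].
  + destruct (G' s I) as [P' E'].
    destruct (Rlt_le_dec (G s) (G t)) as [K|K]; [assumption|].
    destruct (Rle_lt_or_eq_dec _ _ K) as [L|L].
    * specialize (Hi (G t) (G s)); lra.
    * rewrite L in E; lra.
  + rewrite (G0 s) by lra; assumption.
- apply G0; lra.
- intros t Ht; apply (is_derive_inv (fun t => H1 (G t))); [|specialize (H1p t Ht); lra].
  apply (is_derive_comp H1 G t (H2 (G t)) (/ H1 (G t))); [apply Hd2 | now apply Gd].
(* The slope of [G] blows up at [sigma] because that of [H] vanishes at 0. *)
- apply filterlim_comp with (at_right 0); [|apply filterlim_Rinv_0_right].
  intros P [d HP].
  assert (C : continuous (fun t => H1 (G t)) sigma).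
  { apply continuous_comp; [apply Gc; lra|].
    apply @ex_derive_continuous; eexists; apply Hd2. }
  assert (Z : H1 (G sigma) = 0) by (rewrite G0 by lra; apply Hneg; lra).
  destruct (proj1 (filterlim_locally _ _) C d) as [d' N].
  exists d'; intros t Ht Hst; apply HP; [|now apply H1p].
  specialize (N t Ht); cbv beta in N; rewrite Z in N; exact N.
- intros t Ht; replace (mu / 3) with (/ (3 / mu)) by (field; lra).
  apply Rinv_le_contravar; [now apply H1p | exact (proj2 (Hpos (G t) (Gp t Ht)))].
- intros t Ht; destruct (G' t) as [P E]; [lra|].
  rewrite <- (Rinv_inv mu); apply Rinv_le_contravar; [now apply Rinv_0_lt_compat|].
  apply Hsl; lra.
- intros t Ht; specialize (H1p t Ht); specialize (HH (G t)).
  destruct (G' t Ht) as [P E]; rewrite E in HH.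
  set (p := H1 (G t)) in *; set (q := H2 (G t)) in *.
  assert (0 < t) by lra.
  replace (- (- (/ p * q) / p ^ 2)) with (q * t * (/ p ^ 3 * / t)) by (field; lra).
  replace ((/ p) ^ 3 / t) with (1 * (/ p ^ 3 * / t)) by (field; lra).
  apply Rmult_lt_compat_r; [|lra].
  apply Rmult_lt_0_compat; apply Rinv_0_lt_compat; [now apply pow_lt | assumption].
Qed.

(** * The function g and the choice of scales *)
Lemma is_derive_RInt_on (D : R -> Prop) (W : R -> R) c x : open D ->
  (forall x y z, D x -> D z -> x <= y <= z -> D y) ->
  (forall x, D x -> continuous W x) -> D c -> D x ->
  is_derive (fun t => RInt W c t) x (W x).
Proof.
intros HD Hconv HW Hc Hx.
apply (is_derive_RInt W (fun t => RInt W c t) c x); [|now apply HW].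
apply filter_imp with D; [|now apply HD].
intros t Ht; apply @RInt_correct, @ex_RInt_continuous; intros z Hz; apply HW.
destruct (Rle_lt_dec c t) as [I|I].
- rewrite Rmin_left, Rmax_right in Hz by assumption; now apply (Hconv c z t).
- rewrite Rmin_right, Rmax_left in Hz by lra; now apply (Hconv t z c).
Qed.

Definition g1 (lambda t : R) : R := lambda * t / g lambda t.
Definition g2 (lambda t : R) : R := (lambda - g1 lambda t ^ 2) / g lambda t.

Lemma T_spec lambda t : 0 < t -> (Rbar_lt t (T lambda) <-> 0 < lambda * t ^ 2 + 1).
Proof.
intros Ht; unfold T; destruct (Rle_dec 0 lambda) as [I|I]; simpl Rbar_lt.
- split; [intros _; nra | easy].
- assert (S : 0 < sqrt (- lambda)) by (apply sqrt_lt_R0; lra).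
  assert (E : sqrt (- lambda) * sqrt (- lambda) = - lambda) by (apply sqrt_def; lra).
  set (s := sqrt (- lambda)) in *.
  replace (lambda * t ^ 2 + 1) with ((1 - t * s) * (1 + t * s)) by nra.
  assert (0 < t * s) by nra.
  split; intros K.
  + apply Rlt_div_r in K; [nra | assumption].
  + apply Rlt_div_r; [assumption|]; nra.
Qed.

Lemma g_pos lambda t : 0 < lambda * t ^ 2 + 1 -> 0 < g lambda t.
Proof. intros H; now apply sqrt_lt_R0. Qed.

Lemma g_sqr lambda t : 0 < lambda * t ^ 2 + 1 -> g lambda t ^ 2 = lambda * t ^ 2 + 1.
Proof. intros H; apply pow2_sqrt; lra. Qed.

Lemma is_derive_g lambda t : 0 < lambda * t ^ 2 + 1 ->
  is_derive (g lambda) t (g1 lambda t).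
Proof.
intros H; assert (P := g_pos lambda t H); unfold g1.
unfold g in *; auto_derive.
- simpl in H |- *; exact H.
- simpl in P |- *; field; lra.
Qed.

Lemma is_derive_g1 lambda t : 0 < lambda * t ^ 2 + 1 ->
  is_derive (g1 lambda) t (g2 lambda t).
Proof.
intros H; assert (P := g_pos lambda t H).
replace (g2 lambda t)
  with ((lambda * g lambda t - lambda * t * g1 lambda t) / g lambda t ^ 2).
- apply (is_derive_div (fun t => lambda * t) (g lambda)).
  + auto_derive; [exact I | ring].
  + now apply is_derive_g.
  + lra.
- unfold g2, g1; field; lra.
Qed.

Lemma Ck_g n (D : R -> Prop) lambda : open D ->
  (forall t, D t -> 0 < lambda * t ^ 2 + 1) -> Ck n D (g lambda).
Proof.
intros HD HP; induction n as [|n IH]; [easy|].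
apply Ck_of_derive with (g1 lambda); auto using is_derive_g.
apply Ck_div; auto using Ck_scal, Ck_id.
intros t Ht; assert (K := g_pos lambda t (HP t Ht)); lra.
Qed.

(** Both inequalities for [g] come down to [g g' = lambda t]. *)
Lemma g_identities lambda t : 0 < t -> 0 < lambda * t ^ 2 + 1 ->
  g lambda t * g1 lambda t / t = lambda /\
  g lambda t * (g2 lambda t + g1 lambda t ^ 3 / t)
  = lambda - (1 - lambda) * g1 lambda t ^ 2.
Proof.
intros Ht H; assert (P := g_pos lambda t H).
unfold g2; split.
- unfold g1; field; lra.
- replace (g lambda t * ((lambda - g1 lambda t ^ 2) / g lambda t + g1 lambda t ^ 3 / t))
    with (lambda - g1 lambda t ^ 2 + (g lambda t * g1 lambda t / t) * g1 lambda t ^ 2)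
    by (field; lra).
  replace (g lambda t * g1 lambda t / t) with lambda; [ring|].
  unfold g1; field; lra.
Qed.

(** For [t] near 0 the number [g lambda t] is close to 1, so the last three
    inequalities hold for [F] close to [g lambda t] because [lambda < 1]. The
    term [(1 - lambda) / 2] is the amount by which the second derivative of [g]
    may be increased. For negative [lambda] one uses that [F >= g]: the quotient
    [lambda F / g] is then at most [lambda], however large [Rabs lambda] is. *)
Lemma small_scale lambda : lambda < 1 ->
  exists eps0, 0 < eps0 /\ forall eps t F, 0 < t <= eps -> eps < eps0 ->
    0 < lambda * t ^ 2 + 1 /\ Rabs (g1 lambda t) <= 2 * Rabs lambda * t /\
    (g lambda t <= F <= g lambda t + (1 - lambda) / 4 * eps ->
     F <= 3 / 2 /\ F * (lambda / g lambda t) < 1 /\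
     F * (lambda / g lambda t + (1 - lambda) / 2) < 1).
Proof.
intros Hl; set (eta := Rmin (1 / 10) ((1 - lambda) / 20)).
assert (E0 : 0 < eta) by (apply Rmin_pos; lra).
assert (E1 : eta <= 1 / 10) by apply Rmin_l.
assert (E2 : eta <= (1 - lambda) / 20) by apply Rmin_r.
assert (La := Rabs_pos lambda).
exists (Rmin 1 (Rmin (eta / (Rabs lambda + 1)) (eta / ((1 - lambda) / 4)))).
split.
{ repeat apply Rmin_pos; try lra; apply Rdiv_lt_0_compat; lra. }
intros eps t F Ht Heps.
apply Rmin_Rgt in Heps; destruct Heps as [H1 Heps].
apply Rmin_Rgt in Heps; destruct Heps as [H2 H3].
apply Rlt_div_r in H2; [|lra]; apply Rlt_div_r in H3; [|lra].
assert (B : Rabs lambda * t ^ 2 <= eta) by nra.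
assert (L1 := Rle_abs lambda); assert (L2 := Rle_abs (- lambda)); rewrite Rabs_Ropp in L2.
assert (t2 : 0 < t ^ 2) by (apply pow_lt; lra).
assert (B1 : lambda * t ^ 2 <= eta) by nra.
assert (B2 : - eta <= lambda * t ^ 2) by nra.
assert (P : 0 < lambda * t ^ 2 + 1) by lra.
assert (Gp := g_pos lambda t P); assert (Gs := g_sqr lambda t P).
unfold g1; set (G := g lambda t) in *.
assert (G1 : 1 - eta <= G) by nra.
assert (G2 : G <= 1 + eta) by nra.
split; [exact P|]; split.
- rewrite Rabs_div, Rabs_mult, (Rabs_pos_eq t), (Rabs_pos_eq G) by lra.
  apply Rle_div_l; [assumption|].
  assert (0 <= Rabs lambda * t) by nra; nra.
- intros [F1 F2].
  assert (F3 : F <= 1 + 2 * eta) by lra.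
  assert (R1 : F * (lambda / G) <= lambda + (1 - lambda) / 5).
  { replace (F * (lambda / G)) with (lambda * (F / G)) by (field; lra).
    assert (1 <= F / G) by (apply Rle_div_r; lra).
    destruct (Rle_lt_dec lambda 0) as [I|I]; [nra|].
    assert (F / G <= 1 + 4 * eta) by (apply Rle_div_l; nra).
    nra. }
  split; [lra|]; split; [lra|].
  rewrite Rmult_plus_distr_l.
  assert (F * ((1 - lambda) / 2) <= (1 + 2 * eta) * ((1 - lambda) / 2)) by nra.
  nra.
Qed.

(** The slope [k t1] of the steep branch at the transition must be small compared
    with [q], the slope reached by the other branch, and its cube small compared
    with [t1]; both hold for small [t1], the second because [t1^3 / t1] tends
    to 0. *)
Lemma transition_scale k eps q : 1 <= k -> 0 < eps -> 0 < q ->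
  exists t1, 0 < t1 /\ 4 * t1 <= eps /\ 2 * (k * t1) <= q /\ (k * t1) ^ 3 / t1 <= 1 / 2.
Proof.
intros Hk He Hq.
assert (K3 : 1 <= k ^ 3) by (apply pow_R1_Rle; assumption).
exists (Rmin (eps / 4) (Rmin (/ (2 * k ^ 3)) (q / (2 * k)))).
set (t1 := Rmin _ _).
assert (P : 0 < t1).
{ repeat apply Rmin_pos; try lra; [apply Rinv_0_lt_compat; lra|].
  apply Rdiv_lt_0_compat; lra. }
assert (L : t1 <= eps / 4) by apply Rmin_l.
assert (M : t1 <= / (2 * k ^ 3)).
{ apply Rle_trans with (1 := Rmin_r _ _), Rmin_l. }
assert (N : t1 <= q / (2 * k)).
{ apply Rle_trans with (1 := Rmin_r _ _), Rmin_r. }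
apply Rle_div_r in N; [|lra].
split; [assumption|]; split; [lra|]; split; [lra|].
replace ((k * t1) ^ 3 / t1) with (k ^ 3 * t1 * t1) by (field; lra).
assert (M' : t1 * (2 * k ^ 3) <= 1).
{ apply Rle_div_r; [lra|]; now rewrite Rdiv_1_l. }
assert (t1 <= 1) by nra.
nra.
Qed.

(** * Gluing the two branches *)
Lemma step_slope_0 x : x <= 0 \/ 1 <= x -> step_slope x = 0.
Proof.
intros [H|H]; unfold step_slope, bump.
- rewrite (flat_nonpos (-2) 1 x), (flat_nonpos 0 1 x) by assumption.
  unfold Rdiv; ring.
- rewrite (flat_nonpos (-2) 1 (1 - x)), (flat_nonpos 0 1 (1 - x)) by lra.
  unfold Rdiv; ring.
Qed.

Definition switch (t1 t : R) : R := step ((t - t1) / t1).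
Definition switch1 (t1 t : R) : R := step_slope ((t - t1) / t1) / t1.

Lemma is_derive_switch t1 t : 0 < t1 -> is_derive (switch t1) t (switch1 t1 t).
Proof.
intros H; unfold switch1.
replace (step_slope ((t - t1) / t1) / t1)
  with (scal (/ t1) (step_slope ((t - t1) / t1)))
  by (unfold scal; simpl; unfold mult; simpl; field; lra).
apply (is_derive_comp step (fun t => (t - t1) / t1)); [apply is_derive_step|].
auto_derive; [exact I | field; lra].
Qed.

Lemma switch_before t1 t : 0 < t1 -> t <= t1 -> switch t1 t = 0 /\ switch1 t1 t = 0.
Proof.
intros H Ht; assert (K : (t - t1) / t1 <= 0) by (apply Rle_div_l; lra).
unfold switch, switch1; rewrite step_0, step_slope_0 by auto.
split; [easy | unfold Rdiv; ring].
Qed.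

Lemma switch_after t1 t : 0 < t1 -> 2 * t1 <= t -> switch t1 t = 1 /\ switch1 t1 t = 0.
Proof.
intros H Ht; assert (K : 1 <= (t - t1) / t1) by (apply Rle_div_r; lra).
unfold switch, switch1; rewrite step_1, step_slope_0 by auto.
split; [easy | unfold Rdiv; ring].
Qed.

Lemma switch1_nonneg t1 t : 0 < t1 -> 0 <= switch1 t1 t.
Proof.
intros H; apply Rcomplements.Rdiv_le_0_compat; [apply step_slope_nonneg | assumption].
Qed.

Lemma Ck_switch n D t1 : 0 < t1 -> Ck n D (switch t1).
Proof.
intros H; apply (Ck_sub n (fun _ => True)); [easy|].
apply (Ck_comp n _ (fun _ => True) step (fun t => (t - t1) / t1));
  auto using open_true, Ck_step.
apply Ck_div; auto using open_true, Ck_const, Ck_minus, Ck_id.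
intros; lra.
Qed.

(** The derivative of the right-hand branch. Subtracting a function flat at
    [eps] makes the slope negative near 0, whereas [g] has slope about
    [lambda t] there; the coefficient [(1 - lambda) / 4] and the bound 2 on the
    slope of [bump] keep the second derivative within the margin
    [(1 - lambda) / 2]. *)
Definition dip (lambda eps t : R) : R :=
  g1 lambda t - (1 - lambda) / 4 * bump (eps - t).
Definition dip1 (lambda eps t : R) : R :=
  g2 lambda t + (1 - lambda) / 4 * flat (-2) 1 (eps - t).

Lemma is_derive_dip lambda eps t : 0 < lambda * t ^ 2 + 1 ->
  is_derive (dip lambda eps) t (dip1 lambda eps t).
Proof.
intros H.
replace (dip1 lambda eps t) with
  (g2 lambda t - (1 - lambda) / 4 * (-1 * flat (-2) 1 (eps - t)))
  by (unfold dip1; ring).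
apply (is_derive_minus (g1 lambda) (fun t => (1 - lambda) / 4 * bump (eps - t))).
- now apply is_derive_g1.
- apply is_derive_scal.
  apply (is_derive_comp bump (fun t => eps - t)); [apply is_derive_bump|].
  auto_derive; [exact I | ring].
Qed.

Lemma Ck_dip n (D : R -> Prop) lambda eps : open D ->
  (forall t, D t -> 0 < lambda * t ^ 2 + 1) -> Ck n D (dip lambda eps).
Proof.
intros HD HP; apply Ck_minus; [assumption | |].
- apply Ck_div; auto using Ck_scal, Ck_id, Ck_g.
  intros t Ht; assert (K := g_pos lambda t (HP t Ht)); lra.
- apply Ck_scal; [assumption|].
  apply (Ck_comp n _ (fun _ => True) bump (fun t => eps - t)); auto.
  + apply Ck_flat; lra.
  + apply Ck_minus; auto using Ck_const, Ck_id.
Qed.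

(** The derivatives of the branches are interpolated, rather than the branches
    themselves, in order that [switch1] be multiplied by a difference of slopes
    [dip - (- G1)]. This difference is negative on [[t1, 2 t1]], so the term can
    only decrease [f''], and there [f''] is at most a convex combination of the
    second derivatives of the branches. As the slope [f1] is negative there, it
    suffices that each of these be less than [1 / f].

    The estimate [g < f] comes from [f1 < g1] to the left of [eps]. Hence the
    slope of the steep branch has to lie below that of [g] even when [lambda] is
    negative: this is why [mu] is a multiple of [t1] with a factor exceeding
    [12 * Rabs lambda]. *)
Lemma glued_graph lambda eps : lambda < 1 -> 0 < eps ->
  (forall t F, 0 < t <= eps ->
    0 < lambda * t ^ 2 + 1 /\ Rabs (g1 lambda t) <= 2 * Rabs lambda * t /\
    (g lambda t <= F <= g lambda t + (1 - lambda) / 4 * eps ->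
     F <= 3 / 2 /\ F * (lambda / g lambda t) < 1 /\
     F * (lambda / g lambda t + (1 - lambda) / 2) < 1)) ->
  exists (sigma t1 u0 : R) (H G f : R -> R),
    0 < sigma < t1 /\ t1 < eps /\
    (forall n, Ck n (fun _ => True) H) /\
    (forall x, H x * Derive_n H 2 x < 1) /\
    (forall x, 0 <= Derive H x) /\
    (forall x, x <= 0 -> H x = sigma) /\
    (forall x, 0 <= x -> sigma <= H x /\ G (H x) = x) /\
    G sigma = 0 /\
    (forall s t, sigma <= s < t -> G s < G t) /\
    (forall t, t <= t1 -> f t = u0 - G t) /\
    continuous f sigma /\
    (forall n, Ck n (fun t => sigma < t /\ 0 < lambda * t ^ 2 + 1) f) /\
    (forall t, sigma <= t < eps -> g lambda t < f t) /\
    (forall t, eps <= t -> 0 < lambda * t ^ 2 + 1 -> f t = g lambda t) /\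
    (forall t, sigma < t -> 0 < lambda * t ^ 2 + 1 -> profile_ineqs f t) /\
    filterlim (Derive f) (at_right sigma) (Rbar_locally m_infty).
Proof.
intros Hl Heps Small.
set (P := fun t => 0 < lambda * t ^ 2 + 1).
set (q := (1 - lambda) / 4 * bump (eps / 2)).
assert (Hq : 0 < q).
{ apply Rmult_lt_0_compat; [lra | apply flat_pos; lra]. }
assert (La := Rabs_pos lambda).
destruct (transition_scale (12 * Rabs lambda + 1) eps q) as (t1 & Ht1 & Ht1e & Hmuq & Hmu3);
  [lra | lra | assumption |].
set (mu := (12 * Rabs lambda + 1) * t1) in *.
assert (Hmu : 0 < mu) by (apply Rmult_lt_0_compat; lra).
assert (Hmu' : 4 * Rabs lambda * t1 < mu / 3) by (unfold mu; lra).
destruct (steep_graph mu t1 Hmu Ht1) as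
  (sigma & H & G & G1 & G2 & Hs & Hk & HH & HH1 & H0 & HG & Gk & Gc & Gi & G0 &
   Gd1 & Gd2 & Ginf & Glow & Gup & Gineq).
set (D := fun t => sigma < t /\ P t).
assert (Pint : forall s t, 0 <= s <= t -> P t -> P s).
{ unfold P; intros s t Hst Ht.
  assert (0 <= s ^ 2 <= t ^ 2) by (split; [nra | apply pow_incr; lra]).
  destruct (Rle_lt_dec 0 lambda); nra. }
assert (DO : open D).
{ apply open_and; [apply (open_gt sigma)|].
  apply (open_comp (fun t => lambda * t ^ 2 + 1) (fun y => 0 < y)); [|apply open_gt].
  intros t _; apply (ex_derive_continuous (fun t : R => lambda * t ^ 2 + 1)).
  now auto_derive. }
assert (DI : forall x y z, D x -> D z -> x <= y <= z -> D y).
{ intros x y z [Hx _] [_ Hz] Hy; split; [lra|]; apply (Pint y z); [lra | assumption]. }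
assert (De : forall t, sigma < t <= eps -> D t).
{ intros t Ht; split; [lra|]; apply (Small t 0); lra. }
set (A := dip lambda eps); set (A1 := dip1 lambda eps).
set (chi := switch t1); set (chi1 := switch1 t1).
(* [f' = - G1 + W] is the interpolation between [- G1] and [A]. Since [W]
   vanishes on the left of [t1], integrating only [W] keeps [f = u0 - G] there,
   in particular at the end point [sigma], where [G1] is infinite. *)
set (W := fun t => chi t * (A t + G1 t)).
set (W1 := fun t => chi1 t * (A t + G1 t) + chi t * (A1 t + G2 t)).
assert (Ad : forall t, D t -> is_derive A t (A1 t)).
{ intros t Ht; apply is_derive_dip, Ht. }
assert (Wd : forall t, D t -> is_derive W t (W1 t)).
{ intros t Ht; 
  apply (Derive.is_derive_mult chi (fun t => A t + G1 t) t (chi1 t) (A1 t + G2 t)).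
  { now apply is_derive_switch. }
  apply (is_derive_plus A G1); [now apply Ad | apply Gd2, Ht]. }
(* The constant for which [f eps = g lambda eps]. *)
set (u0 := g lambda eps + G eps - RInt W t1 eps).
set (f := fun t => u0 - G t + RInt W t1 t).
set (f1 := fun t => - G1 t + W t).
set (f2 := fun t => - G2 t + W1 t).
assert (fd1 : forall t, D t -> is_derive f t (f1 t)).
{ intros t Ht.
  apply (is_derive_plus (fun t => u0 - G t) (fun t => RInt W t1 t)).
  - replace (- G1 t) with (0 - G1 t) by ring.
    apply (is_derive_minus (fun _ => u0) G); [now auto_derive | apply Gd1, Ht].
  - apply is_derive_RInt_on with D; auto; [|apply De; lra].
    intros x Hx; apply @ex_derive_continuous; exists (W1 x); now apply Wd. }
assert (fd2 : forall t, D t -> is_derive f1 t (f2 t)).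
{ intros t Ht; apply (is_derive_plus (fun t => - G1 t) W); [|now apply Wd].
  apply (is_derive_opp G1), Gd2, Ht. }
assert (f_cap : forall t, t <= t1 -> f t = u0 - G t).
{ intros t Ht; unfold f.
  rewrite (RInt_ext W (fun _ => 0)), RInt_const.
  - unfold scal; simpl; unfold mult; simpl; ring.
  - intros x Hx; rewrite Rmax_left in Hx by assumption.
    unfold W, chi; rewrite (proj1 (switch_before t1 x Ht1 (Rlt_le _ _ (proj2 Hx)))).
    apply Rmult_0_l. }
assert (f_k : forall n, Ck n D f).
{ apply Ck_primitive with f1; auto; intros n.
  assert (G1k : Ck n D G1).
  { apply Ck_ext with (Derive G); auto.
    - intros x Hx; apply is_derive_unique, Gd1, Hx.
    - apply Ck_sub with (fun t => sigma < t); [now intros x [Hx _] | apply (Gk (S n))]. }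
  apply Ck_plus; auto using Ck_opp.
  apply Ck_mult; [assumption | now apply Ck_switch |].
  apply Ck_plus; [assumption | | assumption].
  apply Ck_dip; [assumption | now intros t [_ Ht]]. }
assert (Pg : forall t, sigma <= t -> P t -> 0 < g lambda t) by (intros; now apply g_pos).
assert (g1_small : forall t, 0 < t <= 2 * t1 -> - (mu / 3) < g1 lambda t < mu / 3).
{ intros t Ht; destruct (Small t 0) as (_ & K & _); [lra|].
  apply Rabs_le_between in K.
  assert (2 * Rabs lambda * t <= 4 * Rabs lambda * t1) by nra; lra. }
assert (A_lt : forall t, t < eps -> A t < g1 lambda t).
{ intros t Ht; unfold A, dip.
  assert (0 < bump (eps - t)) by (apply flat_pos; lra); nra. }
assert (A_after : forall t, eps <= t -> A t = g1 lambda t /\ A1 t = g2 lambda t).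
{ intros t Ht; unfold A, dip, A1, dip1, bump.
  rewrite !flat_nonpos by lra; split; ring. }
assert (A_low : forall t, 0 < t <= 2 * t1 -> A t <= - mu).
{ intros t Ht; assert (K := g1_small t Ht).
  assert (B : bump (eps / 2) <= bump (eps - t)) by (apply bump_nondecreasing; lra).
  assert (q <= (1 - lambda) / 4 * bump (eps - t)) by (apply Rmult_le_compat_l; lra).
  unfold A, dip; lra. }
assert (A_ge : forall t, g1 lambda t - (1 - lambda) / 4 <= A t).
{ intros t; assert (K := bump_le_1 (eps - t)); unfold A, dip; nra. }
assert (A1_le : forall t, A1 t <= g2 lambda t + (1 - lambda) / 2).
{ intros t; assert (K := bump_slope_le_2 (eps - t)); unfold A1, dip1; nra. }
assert (chi_range : forall t, 0 <= chi t <= 1) by (intros t; apply step_range).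
assert (f1_before : forall t, t <= t1 -> f1 t = - G1 t /\ f2 t = - G2 t).
{ intros t Ht; destruct (switch_before t1 t Ht1 Ht) as [E1 E2].
  unfold f1, f2, W, W1, chi, chi1; rewrite E1, E2; split; ring. }
assert (f1_after : forall t, 2 * t1 <= t -> f1 t = A t /\ f2 t = A1 t).
{ intros t Ht; destruct (switch_after t1 t Ht1 Ht) as [E1 E2].
  unfold f1, f2, W, W1, chi, chi1; rewrite E1, E2; split; ring. }
assert (f1_mid : forall t, t1 <= t <= 2 * t1 ->
  A t <= f1 t < g1 lambda t /\ f1 t < 0 /\
  f2 t <= (1 - chi t) * (- G2 t) + chi t * A1 t).
{ intros t Ht.
  assert (a1 := A_low t); assert (a2 := Gup t); assert (a3 := Glow t).
  assert (a4 := g1_small t); assert (a5 := A_lt t); assert (c := chi_range t).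
  assert (c1 := switch1_nonneg t1 t Ht1); fold chi1 in c1.
  unfold f1, f2, W, W1; repeat split; nra. }
assert (f1_lt : forall t, sigma < t < eps -> f1 t < g1 lambda t).
{ intros t Ht; destruct (Rle_lt_dec t t1) as [I|I].
  - destruct (f1_before t I) as [-> _].
    assert (K := Glow t); assert (K' := g1_small t); lra.
  - destruct (Rle_lt_dec t (2 * t1)) as [J|J].
    + apply f1_mid; lra.
    + destruct (f1_after t) as [-> _]; [lra|]; apply A_lt; lra. }
assert (f1_ge : forall t, t1 <= t -> A t <= f1 t).
{ intros t I; destruct (Rle_lt_dec t (2 * t1)) as [J|J].
  - apply f1_mid; lra.
  - destruct (f1_after t) as [-> _]; lra. }
assert (fg_d : forall t, D t ->
  is_derive (fun t => f t - g lambda t) t (f1 t - g1 lambda t)).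
{ intros t Ht; apply (is_derive_minus f (g lambda)); [now apply fd1|].
  apply is_derive_g, Ht. }
assert (f_eps : f eps = g lambda eps) by (unfold f, u0; ring).
assert (fg_mvt : forall a b, D a -> D b -> a <= b ->
  exists c, a <= c <= b /\
  (f b - g lambda b) - (f a - g lambda a) = (f1 c - g1 lambda c) * (b - a)).
{ intros a b Ha Hb Hab.
  destruct (MVT_gen (fun t => f t - g lambda t) a b (fun t => f1 t - g1 lambda t))
    as [c [Hc E]]; rewrite ?Rmin_left, ?Rmax_right in * by assumption.
  - intros x Hx; apply fg_d, (DI a x b); auto; lra.
  - intros x Hx; eapply is_derive_continuity_pt, fg_d, (DI a x b); auto.
  - exists c; split; assumption. }
assert (f_eq : forall t, eps <= t -> P t -> f t = g lambda t).
{ intros t Ht HP; destruct (fg_mvt eps t) as [c [Hc E]];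
    [apply De; lra | split; [lra | assumption] | assumption |].
  destruct (f1_after c) as [K _]; [lra|].
  rewrite K, (proj1 (A_after c (proj1 Hc))), f_eps in E; lra. }
(* On [[t1, eps]] the slope of [f] is at least [g1 - (1 - lambda) / 4]. *)
assert (f_up : forall t, t1 <= t <= eps -> f t <= g lambda t + (1 - lambda) / 4 * eps).
{ intros t Ht; destruct (fg_mvt t eps) as [c [Hc E]];
    [apply De; lra | apply De; lra | lra |].
  rewrite f_eps in E.
  assert (K := f1_ge c); assert (K' := A_ge c).
  assert (- ((1 - lambda) / 4) * (eps - t) <= (f1 c - g1 lambda c) * (eps - t)).
  { apply Rmult_le_compat_r; lra. }
  nra. }
assert (f_c0 : continuous f sigma).
{ apply continuous_ext_loc with (fun t => u0 - G t).
  - apply filter_imp with (fun t => t < t1); [|apply (open_lt t1); lra].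
    intros y Hy; symmetry; apply f_cap; lra.
  - apply (continuous_minus (fun _ => u0) G); [apply continuous_const | exact Gc]. }
assert (f_gt : forall t, sigma <= t < eps -> g lambda t < f t).
{ intros t Ht.
  assert (K : - (f t - g lambda t) < - (f eps - g lambda eps)); [|lra].
  apply (strictly_increasing_of_derive (fun t => - (f t - g lambda t))
           (fun t => - (f1 t - g1 lambda t))); [lra | | |].
  - intros x Hx; apply (is_derive_opp (fun t => f t - g lambda t)), fg_d, De; lra.
  - intros x Hx; destruct (Rle_lt_or_eq_dec sigma x) as [I|I]; [lra | |].
    + eapply is_derive_continuity_pt, (is_derive_opp (fun t => f t - g lambda t)), fg_d, De.
      lra.
    + rewrite <- I; apply continuity_pt_filterlim.
      apply (continuous_opp (fun t => f t - g lambda t)).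
      apply (continuous_minus f (g lambda)).
      * exact f_c0.
      * apply @ex_derive_continuous; eexists; apply is_derive_g.
        apply (Small sigma 0); lra.
  - intros x Hx; specialize (f1_lt x); lra. }
assert (Df : forall t, D t -> Derive f t = f1 t).
{ intros t Ht; now apply is_derive_unique, fd1. }
assert (D2f : forall t, D t -> Derive_n f 2 t = f2 t).
{ intros t Ht; simpl; rewrite <- (is_derive_unique f1 t _ (fd2 t Ht)).
  apply Derive_ext_loc; apply filter_imp with D; [exact Df | now apply DO]. }
exists sigma, t1, u0, H, G, f.
repeat match goal with |- _ /\ _ => split; [try assumption|] end.
- lra.
- intros t Ht HP; assert (DT : D t) by now split.
  assert (Ht0 : 0 < t) by lra.
  unfold profile_ineqs; rewrite (Df t DT), (D2f t DT).
  destruct (g_identities lambda t Ht0 HP) as [ID1 ID2]; assert (gp := Pg t (Rlt_le _ _ Ht) HP).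
  destruct (Rle_lt_dec eps t) as [I|I].
  { destruct (f1_after t) as [-> ->]; [lra|].
    destruct (A_after t I) as [-> ->]; rewrite (f_eq t I HP), ID1, ID2; split; nra. }
  assert (ft := f_gt t (conj (Rlt_le _ _ Ht) I)).
  destruct (Rle_lt_dec t t1) as [J|J].
  { destruct (f1_before t J) as [-> ->].
    assert (K := Gineq t Ht); assert (L := Glow t Ht).
    replace ((- G1 t) ^ 3 / t) with (- (G1 t ^ 3 / t)) by (field; lra).
    split; [nra|].
    apply Rlt_div_l; [assumption|]; nra. }
  destruct (Small t (f t)) as (_ & _ & S); [lra|].
  destruct S as (S1 & S2 & S3); [split; [lra | apply f_up; lra]|].
  assert (L : f1 t < g1 lambda t) by (apply f1_lt; lra).
  split.
  2: { apply Rlt_trans with (2 := S2).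
       replace (lambda / g lambda t) with (g1 lambda t / t) by (unfold g1; field; lra).
       unfold Rdiv; rewrite Rmult_assoc; apply Rmult_lt_compat_l; [lra|].
       apply Rmult_lt_compat_r; [now apply Rinv_0_lt_compat | assumption]. }
  assert (R : g2 lambda t + g1 lambda t ^ 3 / t <= lambda / g lambda t).
  { apply Rle_div_r; [assumption|].
    assert (0 <= g1 lambda t ^ 2) by apply pow2_ge_0; nra. }
  (* In the transition the cubic term is negative; beyond it, the slope is at
     most that of [g], and so is its cube. *)
  destruct (Rle_lt_dec t (2 * t1)) as [M|M].
  + destruct (f1_mid t) as (N1 & N2 & N3); [lra|].
    assert (Q0 : f1 t ^ 3 / t <= 0).
    { apply Rle_div_l; [assumption|]; assert (0 <= f1 t ^ 2) by apply pow2_ge_0; nra. }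
    assert (Q1 : f t * A1 t < 1).
    { apply Rle_lt_trans with (2 := S3); apply Rmult_le_compat_l; [lra|].
      assert (g2 lambda t <= lambda / g lambda t); [|specialize (A1_le t); lra].
      unfold g2, Rdiv; apply Rmult_le_compat_r; [apply Rlt_le; now apply Rinv_0_lt_compat|].
      assert (0 <= g1 lambda t ^ 2) by apply pow2_ge_0; lra. }
    assert (Q2 : f t * - G2 t < 1).
    { assert (G1 t ^ 3 / t <= mu ^ 3 / t1).
      { assert (Z1 := Gup t (Rlt_le _ _ J)); assert (Z2 := Glow t Ht).
        apply Rmult_le_compat; [apply pow_le; lra | apply Rlt_le; now apply Rinv_0_lt_compat | |].
        - apply pow_incr; lra.
        - apply Rinv_le_contravar; lra. }
      specialize (Gineq t Ht).
      assert (f t * - G2 t <= f t * (1 / 2)) by (apply Rmult_le_compat_l; lra); lra. }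
    assert (c := chi_range t).
    apply Rle_lt_trans with (f t * ((1 - chi t) * - G2 t + chi t * A1 t)).
    * apply Rmult_le_compat_l; lra.
    * replace (f t * ((1 - chi t) * - G2 t + chi t * A1 t))
        with ((1 - chi t) * (f t * - G2 t) + chi t * (f t * A1 t)) by ring.
      set (a := f t * - G2 t) in *; set (b := f t * A1 t) in *; clearbody a b.
      assert (Rmax a b < 1) by now apply Rmax_lub_lt.
      assert (a <= Rmax a b) by apply Rmax_l; assert (b <= Rmax a b) by apply Rmax_r.
      apply Rle_lt_trans with (Rmax a b); [|assumption]; nra.
  + destruct (f1_after t) as [E1 E2]; [lra|]; rewrite E2.
    apply Rle_lt_trans with (2 := S3); apply Rmult_le_compat_l; [lra|].
    assert (f1 t ^ 3 / t <= g1 lambda t ^ 3 / t).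
    { apply Rmult_le_compat_r; [apply Rlt_le; now apply Rinv_0_lt_compat|].
      assert (f1 t ^ 2 + f1 t * g1 lambda t + g1 lambda t ^ 2 >= 0) by nra; nra. }
    specialize (A1_le t); lra.
- apply filterlim_ext_loc with (fun t => - G1 t).
  { exists (mkposreal (t1 - sigma) ltac:(lra)); intros t Ht Hst.
    change (Rabs (t - sigma) < t1 - sigma) in Ht; apply Rabs_def2 in Ht.
    rewrite Df by (apply De; lra); symmetry; apply f1_before; lra. }
  apply (filterlim_comp _ _ _ G1 Ropp _ (Rbar_locally p_infty)); [exact Ginf|].
  apply (filterlim_Rbar_opp p_infty).
Qed.

Theorem proposition3p3 (lambda : R) (Hlambda : lambda < 1) :
  exists eps0 : R, 0 < eps0 /\
  forall eps : R, 0 < eps < eps0 ->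
  Rbar_lt eps (T lambda) /\
  exists (sigma : R) (f : R -> R),
    0 < sigma < eps /\
    continuous_on (fun t : R => sigma <= t /\ Rbar_lt t (T lambda)) f /\
    (forall t : R, sigma <= t -> Rbar_lt t (T lambda) -> 0 < f t) /\
    smooth_on (fun t : R => sigma < t /\ Rbar_lt t (T lambda)) f /\
    (forall t : R, sigma < t -> Rbar_lt t (T lambda) -> profile_ineqs f t) /\
    (forall t : R, eps <= t -> Rbar_lt t (T lambda) -> f t = g lambda t) /\
    (forall t : R, sigma <= t < eps -> g lambda t < f t) /\
    filterlim (Derive f) (at_right sigma) (Rbar_locally m_infty) /\
    (exists delta : R, 0 < delta /\ Rbar_lt (sigma + delta) (T lambda) /\
       strictly_decreasing_on (fun t : R => sigma <= t < sigma + delta) f /\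
       exists (L : R) (h : R -> R),
         filterlim f (at_left (sigma + delta)) (locally L) /\
         extended_inverse f sigma (sigma + delta) L h /\
         smooth_on (fun u : R => L < u) h /\
         (forall u : R, L < u -> profile_ineqs h u)).
Proof.
destruct (small_scale lambda Hlambda) as (eps0 & He0 & Small).
exists eps0; split; [assumption|]; intros eps Heps.
assert (HT := T_spec lambda).
assert (Peps : forall t, 0 < t <= eps -> 0 < lambda * t ^ 2 + 1).
{ intros t Ht; apply (Small eps t 0); lra. }
split; [apply HT, Peps; lra|].
destruct (glued_graph lambda eps Hlambda) as
  (sigma & t1 & u0 & H & G & f & Hs & Ht1 & Hk & HH & HH1 & H0 & HG & G0 & Gi &
   f_cap & f_c0 & f_k & f_gt & f_eq & f_ineq & f_inf); [lra | intros t F Ht; apply Small; lra |].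
assert (f_pos : forall t, sigma <= t -> Rbar_lt t (T lambda) -> 0 < f t).
{ intros t Ht HTt; assert (P : 0 < lambda * t ^ 2 + 1) by (apply HT; [lra | assumption]).
  assert (gp := g_pos lambda t P).
  destruct (Rlt_le_dec t eps) as [I|I].
  - specialize (f_gt t); lra.
  - now rewrite f_eq. }
assert (f_c : forall t, sigma < t -> 0 < lambda * t ^ 2 + 1 -> continuous f t).
{ intros t Ht P; eapply Ck_continuous; [apply (f_k 1%nat) | now split]. }
assert (f_sigma : f sigma = u0) by (rewrite f_cap, G0 by lra; ring).
exists sigma, f; repeat match goal with |- _ /\ _ => split; [try assumption|] end.
- lra.
- lra.
- intros t [Ht HTt]; eapply filterlim_filter_le_1; [apply filter_le_within|].
  destruct (Rle_lt_or_eq_dec _ _ Ht) as [I|I].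
  + apply f_c; [assumption | apply HT; [lra | assumption]].
  + now subst t.
- apply smooth_on_Ck; intros n; apply Ck_sub with (2 := f_k n).
  intros t [Ht HTt]; split; [assumption | apply HT; [lra | assumption]].
- intros t Ht HTt; apply f_ineq; [assumption | apply HT; [lra | assumption]].
- intros t Ht HTt; apply f_eq; [assumption | apply HT; [lra | assumption]].
(* The inverse branch is [h u = H (u0 - u)]. As [H' >= 0], the slope of [h] is
   at most 0, so both inequalities for [h] follow from [H H'' < 1]. *)
- exists (t1 - sigma); replace (sigma + (t1 - sigma)) with t1 by ring.
  split; [lra|]; split; [apply HT, Peps; lra|]; split.
  { intros s t Hst Ht I; rewrite !f_cap by lra; specialize (Gi s t); lra. }
  assert (HL : 0 < u0 - G t1).
  { rewrite <- f_cap by lra; apply f_pos; [lra | apply HT, Peps; lra]. }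
  assert (hd : forall u, Derive (fun u => H (u0 - u)) u = - Derive H (u0 - u)).
  { intros u; apply is_derive_unique.
    replace (- Derive H (u0 - u)) with (scal (-1) (Derive H (u0 - u)))
      by (unfold scal; simpl; unfold mult; simpl; ring).
    apply (is_derive_comp H (fun u => u0 - u)); [|auto_derive; [exact I | ring]].
    apply Derive_correct, (Hk 1%nat); exact I. }
  assert (hd2 : forall u, Derive_n (fun u => H (u0 - u)) 2 u = Derive_n H 2 (u0 - u)).
  { intros u; change (Derive (Derive (fun u => H (u0 - u))) u = Derive (Derive H) (u0 - u)).
    rewrite (Derive_ext _ (fun u => - Derive H (u0 - u))) by exact hd.
    apply is_derive_unique.
    replace (Derive (Derive H) (u0 - u)) with (- scal (-1) (Derive (Derive H) (u0 - u)))
      by (unfold scal; simpl; unfold mult; simpl; ring).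
    apply (is_derive_opp (fun u => Derive H (u0 - u))).
    apply (is_derive_comp (Derive H) (fun u => u0 - u)); [|auto_derive; [exact I | ring]].
    apply Derive_correct, (Hk 2%nat); exact I. }
  exists (u0 - G t1), (fun u => H (u0 - u)); split; [|split; [|split]].
  + rewrite <- f_cap by lra.
    eapply filterlim_filter_le_1; [apply filter_le_within|].
    apply f_c; [lra | apply Peps; lra].
  + unfold extended_inverse; rewrite f_sigma; split.
    * intros u Hu; destruct (HG (u0 - u)) as [K1 K2]; [lra|].
      assert (K3 : H (u0 - u) < t1).
      { destruct (Rlt_le_dec (H (u0 - u)) t1) as [I|I]; [assumption|].
        destruct (Rle_lt_or_eq_dec _ _ I) as [J|J].
        - specialize (Gi t1 (H (u0 - u))); lra.
        - rewrite <- J in K2; lra. }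
      split; [lra|]; rewrite f_cap, K2 by lra; ring.
    * intros u Hu; apply H0; lra.
  + apply smooth_on_Ck; intros n.
    apply (Ck_comp n _ (fun _ => True) H (fun u => u0 - u)); auto; [apply (open_gt (u0 - G t1))|].
    apply Ck_minus; auto using Ck_const, Ck_id; apply (open_gt (u0 - G t1)).
  + intros u Hu; unfold profile_ineqs; rewrite hd, hd2.
    assert (K := HH (u0 - u)); assert (S := HH1 (u0 - u)).
    assert (Hp : 0 < H (u0 - u)).
    { destruct (Rle_lt_dec (u0 - u) 0) as [I|I].
      - rewrite H0 by assumption; lra.
      - specialize (HG (u0 - u)); lra. }
    set (p := Derive H (u0 - u)) in *.
    assert (up : 0 < / u) by (apply Rinv_0_lt_compat; lra).
    assert (0 <= p ^ 3) by now apply pow_le.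
    split.
    * assert ((- p) ^ 3 / u <= 0); [|nra].
      replace ((- p) ^ 3 / u) with (- (p ^ 3 * / u)) by (unfold Rdiv; ring).
      assert (0 <= p ^ 3 * / u) by (apply Rmult_le_pos; lra); lra.
    * apply Rlt_div_l; nra.
Qed.
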